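(* There exists a $\mathbb{Z}$-subshift which has zero-dimensional topologically completely positive entropy (ZTCPE) but does not have topologically completely positive entropy (TCPE).
   Context: A $\mathbb{Z}$ topological dynamical system $(X,T)$ is a compact metric space $X$ with a homeomorphism $T$ of $X$ (generating the $\mathbb{Z}$-action $\{T^n\}_{n\in\mathbb{Z}}$). For a finite set $A$ (an alphabet), $A^{\mathbb{Z}}$ carries the product of discrete topologies and the shift $\sigma$ given by $(\sigma x)(s)=x(s+1)$. A $\mathbb{Z}$-subshift is a nonempty closed subset $X$ of some $A^{\mathbb{Z}}$ with $\sigma(X)=X$, regarded as the topological dynamical system $(X,\sigma)$. The topological entropy is $h(X,T)=\sup_{\mathcal{U}}\lim_{n\to\infty}\frac1n\log N\left(\bigvee_{i=1}^n T^i\mathcal{U}\right)$, where $\mathcal{U}$ ranges over open covers of $X$ and $N(\cdot)$ is the minimal cardinality of a subcover. A factor map $(X,T)\to(Y,S)$ is a continuous map $\phi:X\to Y$ with $\phi\circ T=S\circ\phi$. $(X,T)$ has TCPE if for every surjective factor map from $(X,T)$ to a $\mathbb{Z}$ topological dynamical system $(Y,S)$, either $h(Y,S)>0$ or $|Y|=1$. $(X,T)$ has ZTCPE if for every surjective factor map from $(X,T)$ to a $\mathbb{Z}$ topological dynamical system $(Y,S)$ with $Y$ zero-dimensional (i.e. having a basis of clopen sets), either $h(Y,S)>0$ or $|Y|=1$. *)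

(* Defs.v *)
From mathcomp Require Import all_boot all_order all_algebra.
From mathcomp Require Import all_classical all_reals all_analysis.

Set Implicit Arguments.
Unset Strict Implicit.
Unset Printing Implicit Defensive.

Import Order.TTheory GRing.Theory Num.Theory.
Import numFieldNormedType.Exports.

Local Open Scope classical_set_scope.
Local Open Scope ring_scope.
Local Open Scope card_scope.

(** Topological dynamical systems *)

Definition homeomorphism {X Y : topologicalType} (f : X -> Y) : Prop :=
  continuous f /\
  exists g : Y -> X, [/\ cancel f g, cancel g f & continuous g].

(* Used with [X : metricType R], so that the phase space is metric. *)
Definition is_tds {X : topologicalType} (T : X -> X) : Prop :=
  compact [set: X] /\ homeomorphism T.

Definition factor_map {X Y : topologicalType} (T : X -> X) (S : Y -> Y)
    (phi : X -> Y) : Prop :=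
  continuous phi /\ phi \o T = S \o phi.

Definition has_clopen_basis (X : topologicalType) : Prop :=
  exists2 B : set (set X), basis B & B `<=` clopen.

(** Topological entropy *)

Definition is_cover {X : Type} (U : set (set X)) : Prop :=
  \bigcup_(A in U) A = [set: X].

Definition open_cover {X : topologicalType} (U : set (set X)) : Prop :=
  U `<=` open /\ is_cover U.

Definition subcover_size {X : Type} (U : set (set X)) : set nat :=
  [set n | exists V : set (set X), [/\ V `<=` U, is_cover V & V #= `I_n]].

(* The default value [0] is only taken when [U] has no finite subcover. *)
Definition min_subcover {X : Type} (U : set (set X)) : nat :=
  xget 0%N [set n | subcover_size U n /\
                    forall m, subcover_size U m -> (n <= m)%N].

(* The cover T U \/ T^2 U \/ .. \/ T^n U, whose members are the intersections
   of one member of each T^i U, 1 <= i <= n. *)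
Definition iterated_join {X : Type} (T : X -> X) (U : set (set X)) (n : nat) :
    set (set X) :=
  [set W | exists2 u : nat -> set X,
     forall i, (1 <= i <= n)%N -> U (u i) &
     W = \bigcap_(i in [set i | (1 <= i <= n)%N]) (iter i T @` u i)].

(* [limn] is total; when [T] is a homeomorphism of a compact space the limit
   exists by subadditivity. *)
Definition cover_entropy (R : realType) {X : Type} (T : X -> X)
    (U : set (set X)) : R :=
  limn (fun n => ln (min_subcover (iterated_join T U n))%:R / n%:R : R).

Definition entropy (R : realType) {X : topologicalType} (T : X -> X) : \bar R :=
  ereal_sup [set (cover_entropy R T U)%:E | U in open_cover].

(** Completely positive entropy *)

Definition TCPE (R : realType) {X : topologicalType} (T : X -> X) : Prop :=
  forall (Y : metricType R) (S : Y -> Y) (phi : X -> Y),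
    is_tds S -> factor_map T S phi -> set_surj setT setT phi ->
    (0 < entropy R S)%E \/ exists y : Y, [set: Y] = [set y].

Definition ZTCPE (R : realType) {X : topologicalType} (T : X -> X) : Prop :=
  forall (Y : metricType R) (S : Y -> Y) (phi : X -> Y),
    is_tds S -> has_clopen_basis Y ->
    factor_map T S phi -> set_surj setT setT phi ->
    (0 < entropy R S)%E \/ exists y : Y, [set: Y] = [set y].

(** Subshifts *)

Notation full_shift A := {ptws int -> discrete_topology A}.

Definition shift {A : finType} (x : full_shift A) : full_shift A :=
  fun s : int => x (s + 1).

Record subshift (A : finType) := Subshift {
  subshift_set :> set (full_shift A);
  subshift_neq0 : subshift_set !=set0;
  subshift_closed : closed subshift_set;
  subshift_shift : shift @` subshift_set = subshift_set
}.

Lemma shift_in (A : finType) (X : subshift A) (x : X) :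
  shift (set_val x) \in (X : set (full_shift A)).
Proof.
rewrite -[in X in _ \in X]subshift_shift; apply/mem_set; exists (set_val x) => //.
exact: set_valP.
Qed.

(* Points of [X : subshift A] form the sigma type [set_type X], which carries
   the subspace topology of [full_shift A]. *)
Definition subshift_map (A : finType) (X : subshift A) (x : X) : X :=
  exist _ (shift (set_val x)) (shift_in x).
Arguments subshift_map {A} X x.

(* Main.v *)
Require Import Defs.
From mathcomp Require Import all_boot all_order all_algebra.
From mathcomp Require Import all_classical all_reals all_analysis.
From HB Require Import structures.
From mathcomp Require Import zify ring lra.

(** The subshift consists of codings of integer walks that follow a line.
    Given integers [p], [q], [b] with [0 < q] and [2 q <= p <= 3 q], call a walk
    [S : int -> int] admissible when its graph stays within vertical distance
    [1] of the line of slope [p / q] and height [b / q] at time [0].  Its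
    increments then range over 0, ..., 5, hence form a sequence over six letters;
    [balanced_subshift] is the closure of all sequences obtained this way.

    It does not have TCPE.  In a balanced sequence every prefix sum of length
    [n] is within [2] of [n] times the slope of the line, uniformly.  So the
    slope extends to a continuous shift-invariant function on the closure, that
    is, to a factor map onto a space of real numbers on which the dynamics is
    the identity.  The identity has zero entropy, and both slopes 2 and 3 occur.

    It has ZTCPE.  Let [phi] be a factor map onto a zero-entropy system and [D]
    a clopen set of the factor.  By compactness, whether [phi x] lies in [D] is
    decided by the letters of [x] in a bounded window.  Two facts show that the
    answer is the same for all [x].

    - Two walks along the same line get the same answer ([same_line_status]).
      Admissibility constrains the heights at distinct times independently, and
      the constraint is periodic up to a translation of the walk, because the
      slope is rational.  So copies of long pieces of the two walks may be
      concatenated in any order ([tube_glue]).  If the answers differed, every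
      0-1 sequence would be the [D]-name of an orbit read at the multiples of
      some [L], and the cover by [D] and its complement would have positive
      entropy ([entropy_gt0_of_names]).

    - A strip of half-width 1 around a line contains an integer walk with room
      to spare: the staircase below the line only uses half of the strip.  So a
      staircase also follows, over the whole window, any line of sufficiently
      close slope ([staircase_transfer]).  Moving from slope to slope in
      small steps connects every line to the line of slope 2
      ([invariant_slope_two]); this is how connectedness of the set of slopes
      enters.

    Balanced sequences are dense, so the window carries the conclusion over to
    the closure: [D] contains the whole factor or misses it.  As the clopen sets
    of a zero-dimensional metric space separate points, the factor is a single
    point. *)

Set Implicit Arguments.
Unset Strict Implicit.
Unset Printing Implicit Defensive.

Import Order.TTheory GRing.Theory Num.Theory.
Import numFieldNormedType.Exports.

Local Open Scope classical_set_scope.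
Local Open Scope ring_scope.
Local Open Scope card_scope.

(** * Entropy of covers and factors *)

Section covers.
Context {X : Type}.
Implicit Types (U : set (set X)) (T : X -> X).

(** Families are indexed by the integers below [k], with possible repetitions:
    this is easier to build than a subcover of exact cardinality, and the two
    agree as far as the minimum is concerned. *)
Definition covered_by U (k : nat) : Prop := exists g : nat -> set X,
  (forall i, (i < k)%N -> U (g i)) /\ (forall x, exists2 i, (i < k)%N & g i x).

Lemma subcover_size_covered_by U n : subcover_size U n -> covered_by U n.
Proof.
move=> [V [VU Vc /card_esym/card_set_bijP[f [fV _ fsurj]]]].
exists f; split=> [i ilt|x]; first by apply/VU/fV.
have [A VA Ax] : (\bigcup_(A in V) A) x by move: Vc; rewrite /is_cover => ->.
by have [i ilt fi] := fsurj _ VA; exists i; rewrite ?fi.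
Qed.

Lemma covered_by_subcover_size U k : covered_by U k ->
  exists2 m, (m <= k)%N & subcover_size U m.
Proof.
move=> [g [gU gc]]; pose V := g @` `I_k.
have Vk : V #<= `I_k by exact: card_image_le.
have /finite_setP[m Vm] : finite_set V by apply/finite_image/finite_II.
exists m.
  rewrite -card_le_II; apply: card_le_trans Vk.
  by move: Vm; rewrite card_eq_le => /andP[].
exists V; split => //; first by move=> _ [i ik <-]; exact: gU.
apply/seteqP; split => // x _.
by have [i ik gx] := gc x; exists (g i) => //; exists i.
Qed.

(** A cover without finite subcover gives [min_subcover] its default value;
    the hypothesis rules this out. *)
Lemma min_subcoverP U k : covered_by U k ->
  (min_subcover U <= k)%N /\ covered_by U (min_subcover U).
Proof.
move=> /covered_by_subcover_size[m mk Um].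
have [n [Un nmin]] : exists n, subcover_size U n /\
    forall m, subcover_size U m -> (n <= m)%N.
  have ex : exists n, `[< subcover_size U n >] by exists m; apply/asboolP.
  exists (ex_minn ex); case: ex_minnP => n /asboolP Un nmin; split => // j /asboolP.
  exact: nmin.
rewrite /min_subcover.
case: xgetP => [j -> [Uj jmin]|/(_ n)[]//].
by split; [exact: leq_trans (jmin _ Um) mk|exact: subcover_size_covered_by].
Qed.

Lemma iter_cancel T (T' : X -> X) i : cancel T T' -> cancel (iter i T) (iter i T').
Proof.
move=> TK; elim: i => [//|i IH] x.
by rewrite iterSr iterS TK IH.
Qed.

(** Pulling back along the inverse, rather than pushing forward, turns
    membership in a cell of the join into a condition on the backward orbit. *)
Lemma iterated_joinE T (T' : X -> X) U n : cancel T T' -> cancel T' T ->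
  iterated_join T U n = [set W | exists2 u : nat -> set X,
     forall i, (1 <= i <= n)%N -> U (u i) &
     W = [set x | forall i, (1 <= i <= n)%N -> u i (iter i T' x)]].
Proof.
move=> TK T'K; apply/seteqP.
have e (u : nat -> set X) :
    \bigcap_(i in [set i | (1 <= i <= n)%N]) (iter i T @` u i) =
    [set x | forall i, (1 <= i <= n)%N -> u i (iter i T' x)].
  apply/seteqP; split => x /= h i hi.
    by have [y uy <-] := h i hi; rewrite (iter_cancel _ TK).
  by exists (iter i T' x); [exact: h|rewrite (iter_cancel _ T'K)].
by split => W [u uU ->]; exists u => //; rewrite e.
Qed.

(** The join over [n + m] steps refines the join over [n] steps and the [n]-th
    image of the join over [m] steps, so cells of the two may be intersected. *)
Lemma covered_by_join T T' U n m a b : cancel T T' -> cancel T' T ->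
  covered_by (iterated_join T U n) a -> covered_by (iterated_join T U m) b ->
  covered_by (iterated_join T U (n + m)) (a * b).
Proof.
move=> TK T'K; rewrite !(iterated_joinE _ _ TK T'K) => -[f [fU fc]] [g [gU gc]].
(* pairs of indices are encoded as [i * b + j] *)
exists (fun i => f (i %/ b)%N `&` (iter n T') @^-1` (g (i %% b)%N)); split.
  move=> i iab; have b0 : (0 < b)%N by move: iab; case: b {g gU gc} => //; rewrite muln0.
  have ilt : (i %/ b < a)%N by rewrite ltn_divLR.
  have jlt : (i %% b < b)%N by rewrite ltn_mod.
  have [u uU ->] := fU _ ilt; have [v vU ->] := gU _ jlt.
  exists (fun i => if (i <= n)%N then u i else v (i - n)%N).
    by move=> j hj; case: ifPn => jn; [apply: uU|apply: vU]; lia.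
  apply/seteqP; split => x /=.
    move=> [h1 h2] j hj; case: ifPn => jn; first by apply: h1; lia.
    by have := h2 (j - n)%N; rewrite -iterD subnK; [apply|]; lia.
  move=> h; split => j hj.
    by have := h j; rewrite ifT; [apply|]; lia.
  have := h (j + n)%N; rewrite ifF; last by lia.
  by rewrite addnK iterD; apply; lia.
move=> x; have [i ia fx] := fc x; have [j jb gx] := gc (iter n T' x).
exists (i * b + j)%N.
  apply: (@leq_trans (i.+1 * b)); first by rewrite mulSnr ltn_add2l.
  by rewrite leq_mul2r ia orbT.
by rewrite divnMDl ?modnMDl ?divn_small ?modn_small ?addn0//; lia.
Qed.

Lemma covered_by_join0 T U : covered_by (iterated_join T U 0) 1.
Proof.
exists (fun=> setT); split => [i _|x]; last by exists 0%N.
exists (fun=> setT); first by case.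
by apply/seteqP; split => // x _ [].
Qed.

Lemma covered_by_join1 T T' U k : cancel T T' -> cancel T' T ->
  covered_by U k -> covered_by (iterated_join T U 1) k.
Proof.
move=> TK T'K [g [gU gc]]; rewrite (iterated_joinE _ _ TK T'K).
exists (fun i => T' @^-1` (g i)); split => [i ik|x]; last exact: gc.
exists (fun=> g i) => [_ _|]; first exact: gU.
apply/seteqP; split => x /= h; first by case=> [|[]].
by have := h 1%N; apply.
Qed.

Lemma covered_by_joins T T' U k n : cancel T T' -> cancel T' T ->
  covered_by U k -> exists m, covered_by (iterated_join T U n) m.
Proof.
move=> TK T'K Uk; elim: n => [|n [m IH]]; first by exists 1%N; exact: covered_by_join0.
exists (m * k)%N; rewrite -addn1; apply: covered_by_join IH _ => //.
exact: covered_by_join1 Uk.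
Qed.

Lemma min_subcover_join T T' U k n m : cancel T T' -> cancel T' T ->
  covered_by U k ->
  (min_subcover (iterated_join T U (n + m)) <=
   min_subcover (iterated_join T U n) * min_subcover (iterated_join T U m))%N.
Proof.
move=> TK T'K Uk.
have [a /min_subcoverP[_ ha]] := covered_by_joins n TK T'K Uk.
have [b /min_subcoverP[_ hb]] := covered_by_joins m TK T'K Uk.
exact: (min_subcoverP (covered_by_join TK T'K ha hb)).1.
Qed.

Lemma min_subcover_gt0 T T' U k n : cancel T T' -> cancel T' T ->
  covered_by U k -> inhabited X -> (0 < min_subcover (iterated_join T U n))%N.
Proof.
move=> TK T'K Uk [x].
have [a /min_subcoverP[_ [g [_ /(_ x)[i ilt _]]]]] := covered_by_joins n TK T'K Uk.
exact: leq_ltn_trans ilt.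
Qed.

Lemma covered_by_setC (D : set X) : covered_by [set D; ~` D] 2.
Proof.
exists (fun i => if i == 0%N then D else ~` D); split.
  by move=> [|i] _ /=; [left|right].
by move=> x; have [Dx|Dx] := pselect (D x); [exists 0%N|exists 1%N].
Qed.

End covers.

(** Fekete's lemma: for fixed [k], Euclidean division of [n] by [k] bounds
    [a n / n] by [a k / k] up to [O(1 / n)], so the limit is the infimum. *)
Lemma subadditive_cvg (R : realType) (a : nat -> R) :
  (forall n, 0 <= a n) -> (forall n m, a (n + m)%N <= a n + a m) ->
  cvgn (fun n => a n / n%:R).
Proof.
move=> a0 asub.
pose E := [set a n / n%:R | n in [set n : nat | (0 < n)%N]].
have Einf : has_inf E.
  split; first by exists (a 1%N / 1%:R), 1%N.
  by exists 0 => _ [n n0 <-]; rewrite divr_ge0.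
have amul k q r : a (q * k + r)%N <= a 0%N + q%:R * a k + r%:R * a 1%N.
  elim: q => [|q IH].
    rewrite mul0n add0n mul0r addr0; elim: r => [|r IH]; first by rewrite mul0r addr0.
    rewrite -addn1 (le_trans (asub _ _))// natrD mulrDl mul1r addrA lerD2r.
    exact: IH.
  rewrite mulSn -addnA (le_trans (asub _ _))// -addn1 natrD mulrDl mul1r.
  by have := lerD (lexx (a k)) IH; lra.
apply/cvg_ex; exists (inf E); apply/cvgrPdist_le => e e0.
have e20 : 0 < e / 2 by rewrite divr_gt0.
have [_ [k k0 <-] ak] := inf_adherent e20 Einf.
pose C := a 0%N + k%:R * a 1%N.
near=> n.
have n0 : (0 < n)%N by near: n; exists 1%N.
have nR : 0 < n%:R :> R by rewrite ltr0n.
have low : inf E <= a n / n%:R by apply: ge_inf; [exact: Einf.2|exists n].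
rewrite distrC ger0_norm ?subr_ge0// lerBlDl.
have Cn : C / n%:R <= e / 2.
  rewrite ler_pdivrMr// mulrC -ler_pdivrMr//.
  by near: n; apply: nbhs_infty_ger.
suff : a n / n%:R <= a k / k%:R + C / n%:R by move: ak Cn; lra.
rewrite ler_pdivrMr// mulrDl divfK ?gt_eqF// {1}(divn_eq n k).
apply: (le_trans (amul _ _ _)).
have h1 : (n %/ k)%:R * a k <= a k / k%:R * n%:R.
  rewrite -mulrA mulrC ler_wpM2l// mulrC ler_pdivlMr ?ltr0n// -natrM ler_nat.
  exact: leq_trunc_div.
have h2 : (n %% k)%:R * a 1%N <= k%:R * a 1%N.
  by rewrite ler_wpM2r// ler_nat ltnW// ltn_mod.
by rewrite /C; lra.
Unshelve. all: by end_near. Qed.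

Section entropy_bounds.
Variable R : realType.

Lemma cover_entropy_cvg (X : Type) (T T' : X -> X) U k :
  cancel T T' -> cancel T' T -> covered_by U k -> inhabited X ->
  cvgn (fun n => ln (min_subcover (iterated_join T U n))%:R / n%:R : R).
Proof.
move=> TK T'K Uk X0; pose N n := min_subcover (iterated_join T U n).
have N0 n : (0 < N n)%N by exact: min_subcover_gt0 Uk X0.
apply: (@subadditive_cvg R (fun n => ln (N n)%:R)) => [n|n m].
  by rewrite ln_ge0// ler1n.
rewrite -lnM ?posrE ?ltr0n// -natrM ler_ln ?posrE ?ltr0n ?muln_gt0 ?N0//.
by rewrite ler_nat; exact: min_subcover_join Uk.
Qed.

(** A cell of the join determines which of the points [T'^L x, ..., T'^(m L) x]
    lie in [D], for [x] in the cell.  So [x = T^(m L) y] and [x' = T^(m L) y']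
    need distinct cells when [y] and [y'] have distinct names of length [m]. *)
Lemma names_min_subcover (X : Type) (T T' : X -> X) (D : set X) L m n :
  cancel T T' -> cancel T' T -> (0 < L)%N -> (m * L <= n)%N ->
  (forall c : nat -> bool, exists y, forall k, D (iter (k * L) T y) <-> c k) ->
  (2 ^ m <= min_subcover (iterated_join T [set D; ~` D] n))%N.
Proof.
move=> TK T'K L0 mLn names.
have [a /min_subcoverP[_ []]] := covered_by_joins n TK T'K (covered_by_setC D).
rewrite (iterated_joinE _ _ TK T'K); set N := min_subcover _ => g [gU gc].
have yP (c : {ffun 'I_m -> bool}) :
    {y | forall k : 'I_m, D (iter (k * L) T y) <-> c k}.
  apply: cid; have [y yc] := names (fun k => if insub k is Some i then c i else false).
  by exists y => k; rewrite yc valK.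
pose y c := projT1 (yP c).
have zP (c : {ffun 'I_m -> bool}) : {i : 'I_N | g i (iter (m * L) T (y c))}.
  by apply: cid; have [i iN gi] := gc (iter (m * L) T (y c)); exists (Ordinal iN).
have inj : injective (fun c => projT1 (zP c)).
  move=> c c' cc'; apply/ffunP => k.
  pose i := ((m - k) * L)%N.
  have ki : (m * L = i + k * L)%N by rewrite -mulnDl subnK// ltnW.
  have hi : (1 <= i <= n)%N.
    rewrite muln_gt0 subn_gt0 ltn_ord L0/= (leq_trans _ mLn)// leq_mul2r leq_subr orbT.
    by [].
  have back c0 : iter i T' (iter (m * L) T (y c0)) = iter (k * L) T (y c0).
    by rewrite ki iterD iter_cancel.
  have := projT2 (zP c); have := projT2 (zP c'); rewrite -cc'.
  have [u uU ->] := gU _ (ltn_ord (projT1 (zP c))).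
  move=> /(_ i hi) + /(_ i hi); rewrite !back.
  have := projT2 (yP c) k; have := projT2 (yP c') k; rewrite -/(y c) -/(y c').
  by have [->|->]/= := uU i hi => e e' d d';
  apply/idP/idP; [move=> /e'|move=> /e|move=> /e'|move=> /e]; tauto.
rewrite -[m in (2 ^ m)%N]card_ord -card_bool -card_ffun -[leqRHS]card_ord.
exact: leq_card inj.
Qed.

(** The cover by [D] and its complement has entropy at least [ln 2 / L]; half
    of that is a more convenient bound, as it absorbs the rounding of [n / L]. *)
Lemma entropy_gt0_of_names (X : topologicalType) (T : X -> X) (D : set X) L :
  homeomorphism T -> clopen D -> (0 < L)%N ->
  (forall c : nat -> bool, exists y, forall k, D (iter (k * L) T y) <-> c k) ->
  (0 < entropy R T)%E.
Proof.
move=> [_ [T' [TK T'K _]]] [Do Dc] L0 names.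
pose U := [set D; ~` D].
have UD : covered_by U 2 := covered_by_setC D.
have X0 : inhabited X by have [y _] := names (fun=> true); exists.
have Uo : open_cover U.
  split=> [_ [->|->]//|]; first by rewrite openC.
  apply/seteqP; split => // x _; have [Dx|Dx] := pselect (D x).
    by exists D => //; left.
  by exists (~` D) => //; right.
apply: (@lt_le_trans _ _ (ln 2 / (2 * L%:R) : R)%:E).
  by rewrite lte_fin divr_gt0 ?ln_gt0 ?ltr1n// mulr_gt0 ?ltr0n.
apply: le_trans (ereal_sup_ubound _); last by exists U.
rewrite lee_fin; apply: limr_ge; first exact: cover_entropy_cvg UD X0.
near=> n.
have Ln : (L <= n)%N by near: n; exists L.
have n0 : (0 < n)%N by exact: leq_trans Ln.
have := names_min_subcover TK T'K L0 (leq_divM n L) names.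
rewrite -/U; move: (min_subcover _) => N hN.
rewrite ler_pdivrMr ?mulr_gt0 ?ltr0n// mulrAC ler_pdivlMr ?ltr0n//.
apply: (@le_trans _ _ (ln (2 ^ (n %/ L))%:R * (2 * L%:R))); last first.
  rewrite ler_wpM2r ?mulr_ge0//.
  by rewrite ler_ln ?posrE ?ltr0n ?(leq_trans _ hN) ?expn_gt0// ler_nat.
rewrite natrX lnXn// -[ln _ *+ _]mulr_natr -mulrA ler_pM2l ?ln_gt0 ?ltr1n//.
rewrite -!natrM ler_nat.
have q0 : (0 < n %/ L)%N by rewrite divn_gt0.
have := ltn_ceil n L0; rewrite mulSn mulnCA mul2n -addnn => /ltnW/leq_trans; apply.
by rewrite leq_add2r leq_pmull.
Unshelve. all: by end_near. Qed.

(** Up to refinement the join of a cover with itself is the cover, so the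
    counts are bounded in [n]; for a cover without finite subcover they are all
    the default value. *)
Lemma entropy_id_le0 (X : topologicalType) : (entropy R (@id X) <= 0)%E.
Proof.
apply: ge_ereal_sup => _ [U _ <-]; rewrite lee_fin.
have idK : cancel (@id X) id by [].
have joinU n k : (0 < n)%N -> covered_by (iterated_join id U n) k <-> covered_by U k.
  move=> n0; rewrite (iterated_joinE _ _ idK idK).
  have iid i (x : X) : iter i id x = x by elim: i.
  split=> -[g [gU gc]].
    have gV i : exists V, (i < k)%N -> U V /\ g i `<=` V.
      have [ik|] := ltnP i k; last by exists setT.
      have [u uU ->] := gU i ik; exists (u 1%N) => _; split; first exact: uU.
      by move=> x /(_ 1%N n0).
    have [V VP] := choice gV; exists V; split => [i /VP[]//|x].
    by have [i ik gx] := gc x; exists i => //; exact: (VP i ik).2.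
  exists g; split => // i ik; exists (fun=> g i) => [? _|]; first exact: gU.
  apply/seteqP; split => x /=; first by move=> gx j _; rewrite iid.
  by move/(_ 1%N n0).
have [K NK] : exists K, forall n, (0 < n)%N ->
    (min_subcover (iterated_join id U n) <= K)%N.
  have [[k Uk]|noU] := pselect (exists k, covered_by U k).
    by exists k => n n0; apply: (min_subcoverP _).1; exact/joinU.
  exists 0%N => n n0; rewrite /min_subcover; case: xgetP => [j -> [Uj _]|//].
  exfalso; apply: noU; eexists.
  by apply/(joinU n _ n0); exact: subcover_size_covered_by Uj.
have h : (fun n => ln (min_subcover (iterated_join id U n))%:R / n%:R : R)
    @ \oo --> (0 : R).
  apply/cvgrPdist_le => e e0; near=> n.
  have n0 : (0 < n)%N by near: n; exists 1%N.
  have Ne : ln K.+1%:R / e <= n%:R :> R by near: n; apply: nbhs_infty_ger.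
  rewrite sub0r normrN.
  have [->|N0] := eqVneq (min_subcover (iterated_join id U n)) 0%N.
    by rewrite ln0// mul0r normr0 ltW.
  rewrite ger0_norm; last by rewrite divr_ge0// ln_ge0// ler1n lt0n.
  rewrite ler_pdivrMr ?ltr0n// mulrC -ler_pdivrMr// (le_trans _ Ne)//.
  rewrite ler_pM2r ?invr_gt0// ler_ln ?posrE ?ltr0n// ?lt0n//.
  by rewrite ler_nat (leq_trans (NK n n0)).
by rewrite /cover_entropy (cvg_lim _ h).
Unshelve. all: by end_near. Qed.

End entropy_bounds.

(** * Topology of sequence spaces *)

Section sequences.
Variable A : finType.
Implicit Types x y : full_shift A.

Definition agree (w : nat) (x y : full_shift A) : Prop :=
  forall n : int, `|n| <= w%:Z -> x n = y n.

Lemma agree_sym w x y : agree w x y -> agree w y x.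
Proof. by move=> xy n /xy. Qed.

Lemma agree_trans w x y z : agree w x y -> agree w y z -> agree w x z.
Proof. by move=> xy yz n nw; rewrite xy// yz. Qed.

Lemma agreeW w v x y : (w <= v)%N -> agree v x y -> agree w x y.
Proof. by move=> wv xy n nw; apply: xy; lia. Qed.

Lemma nbhs_coord x (n : int) : nbhs x [set y : full_shift A | x n = y n].
Proof.
have h := @proj_continuous _ (fun _ : int => discrete_topology A) n x.
have xn := @discrete_set1 (discrete_topology A) (x n).
have h2 : nbhs x (proj n @^-1` [set x n]) by exact: h _ xn.
have FF : Filter (nbhs (x : full_shift A)) by exact: nbhs_filter.
by apply: (@filterS _ _ FF _ _ _ h2) => y /= e; exact: (esym e).
Qed.

Lemma nbhs_agree w x : nbhs x (agree w x).
Proof.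
elim: w => [|w IH].
  apply: filterS (nbhs_coord x 0) => y /= e n n0.
  by have -> : n = 0 by lia.
apply: filterS (filterI IH
  (filterI (nbhs_coord x w.+1%:Z) (nbhs_coord x (- w.+1%:Z)))).
move=> y [xy [/= e1 e2]] n nw.
have [nw'|nw'] := leP `|n| w%:Z; first exact: xy.
by have [->|->] : n = w.+1%:Z \/ n = - w.+1%:Z by lia.
Qed.

(** Cylinders generate the neighbourhoods: the filter they generate converges
    coordinatewise to [x], hence converges to [x] in the product topology. *)
Lemma nbhs_agreeP x (U : set (full_shift A)) :
  nbhs x U <-> exists w, agree w x `<=` U.
Proof.
split=> [xU|[w xwU]]; last exact: filterS xwU (nbhs_agree w x).
pose F : set_system (full_shift A) := filter_from setT (fun w => agree w x).
have FF : Filter F.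
  apply: filter_from_filter; first by exists 0%N.
  move=> i j _ _; exists (maxn i j) => // y xy.
  by split; apply: agreeW xy; rewrite ?leq_maxl ?leq_maxr.
suff /(_ _ xU)[w _ xwU] : F --> x by exists w.
apply/cvg_sup => i; apply/cvg_image.
  by apply/seteqP; split => // a _; exists (fun=> a).
move=> B /= /nbhs_singleton Bxi; exists ((fun f : full_shift A => f i) @^-1` B).
  by exists (absz i) => // y xy /=; rewrite -(xy i)//; lia.
by rewrite image_preimage//; apply/seteqP; split => // a _; exists (fun=> a).
Qed.

Lemma full_shift_compact : compact [set: full_shift A].
Proof.
have := @tychonoff int (fun=> discrete_topology A) (fun=> setT).
have -> : [set f : int -> discrete_topology A |
    forall i, [set: discrete_topology A] (f i)] = setT.
  by apply/seteqP; split.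
by apply => i; apply/finite_compact; exact: (@finite_finset A).
Qed.

Lemma closureP (E : set (full_shift A)) x :
  closure E x <-> forall w, exists2 y, E y & agree w x y.
Proof.
split=> [Ex w|h B /nbhs_agreeP[w xB]].
  by have [y [Ey xy]] := Ex _ (nbhs_agree w x); exists y.
by have [y Ey xy] := h w; exists y; split => //; exact: xB.
Qed.

Lemma iter_shift k x : iter k Defs.shift x = (fun n : int => x (n + k%:Z)).
Proof.
elim: k x => [|k IH] x; first by apply/funext => n; rewrite addr0.
by rewrite iterSr IH; apply/funext => n; rewrite /Defs.shift; congr (x _); lia.
Qed.

End sequences.

Lemma compact_set_type (M : topologicalType) (K : set M) :
  compact K -> compact [set: set_type K].
Proof.
move=> Kc F PF _; pose G := (@set_val M K) @ F.
have GK : G K.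
  by apply: (@filterS _ F _ setT); [move=> x _; exact: set_valP|exact: filterT].
have [p [Kp pG]] := Kc G _ GK.
exists (exist _ p (mem_set Kp)); split => // B C FB [_ [[V Vo <-] /= Vp VC]].
have GB : G (set_val @` B) by apply: (@filterS _ F _ B) => // x Bx; exists x.
have [_ [[x Bx <-] Vx]] := pG _ _ GB (open_nbhs_nbhs (conj Vo Vp)).
by exists x; split => //; exact: VC.
Qed.

Section subspace.
Variables (A : finType) (X : set (full_shift A)).

Lemma set_type_nbhsP (x : X) (V : set X) :
  nbhs x V <-> exists w, forall y : X, agree w (set_val x) (set_val y) -> V y.
Proof.
split=> [[_ [[U Uo <-] /= Ux UV]]|[w wV]].
  have /nbhs_agreeP[w wU] := open_nbhs_nbhs (conj Uo Ux).
  by exists w => y xy; apply: UV; exact: wU.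
apply: (@filterS _ _ _ (set_val @^-1` agree w (set_val x))) => //.
exact: initial_continuous (nbhs_agree w (set_val x)).
Qed.

(** A clopen set is locally constant, and compactness makes the size of the
    window that decides membership uniform. *)
Lemma clopen_window (C : set X) : closed X -> clopen C ->
  exists w, forall x y : X, agree w (set_val x) (set_val y) -> C x -> C y.
Proof.
move=> Xc [Co Cc].
have /compact_set_type/compact_near_coveringP cov : compact X.
  by apply: subclosed_compact Xc (@full_shift_compact A) _.
have /cov : forall x : X, setT x -> \forall x' \near x & w \near \oo,
    forall y : X, agree w (set_val x') (set_val y) -> C x' -> C y.
  move=> x _.
  have [w wC] : exists w, forall y : X, agree w (set_val x) (set_val y) -> C x <-> C y.
    have [Cx|Cx] := pselect (C x).
      have /set_type_nbhsP[w wC] := open_nbhs_nbhs (conj Co Cx).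
      by exists w => y /wC.
    have oC : open (~` C) by rewrite openC.
    have /set_type_nbhsP[w wC] := open_nbhs_nbhs (conj oC (Cx : (~` C) x)).
    by exists w => y /wC.
  exists ([set x' : X | agree w (set_val x) (set_val x')], [set v | (w <= v)%N]).
    by split; [apply/set_type_nbhsP; exists w|exists w].
  move=> [x' v] /= [xx' wv] y x'y.
  have xy : agree w (set_val x) (set_val y).
    by apply: agree_trans xx' _; exact: agreeW x'y.
  by rewrite -(wC _ xx') -(wC _ xy).
move=> [w _ /(_ w (leqnn w)) h].
by exists w => x y; exact: (h x I y).
Qed.

End subspace.

(** * Walks close to a line *)

(** Distance at most 1 from the line [(p n + b) / q], with denominators cleared so
    that everything stays in the integers. *)
Definition tube (p q b : int) (S : int -> int) : Prop :=
  forall n, `|q * S n - p * n - b| <= q.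

(** A walk is coded by its increments.  In a tube whose slope lies between
    2 and 3 they are at least 0 and at most 5, so that [inord] truncates
    nothing; this is the reason for keeping slopes away from 0. *)
Definition increments (S : int -> int) : int -> 'I_6 :=
  fun n => inord (absz (S (n + 1) - S n)%R).

Lemma tube_step p q b S n : 0 < q -> 2 * q <= p <= 3 * q -> tube p q b S ->
  0 <= S (n + 1) - S n <= 5.
Proof.
move=> q0 /andP[p2 p3] St; have := St n; have := St (n + 1).
rewrite !ler_norml => /andP[a1 a2] /andP[a3 a4].
set d := S (n + 1) - S n.
have e : q * d = q * S (n + 1) - q * S n by rewrite /d; ring.
have h1 : 0 <= q * d by lia.
have h2 : q * d <= q * 5 by lia.
by rewrite -(pmulr_rge0 _ q0) h1 -(ler_pM2l q0) h2.
Qed.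

Lemma increments_val p q b S n : 0 < q -> 2 * q <= p <= 3 * q -> tube p q b S ->
  (increments S n : nat)%:Z = S (n + 1) - S n.
Proof.
move=> q0 pq St; have /andP[] := tube_step n q0 pq St.
rewrite /increments; move: (_ - _) => d h1 h2.
by rewrite inordK ?gez0_abs //; lia.
Qed.

(** The highest integer walk below the line of slope [p / q] through [0]. *)
Definition staircase (p q : int) (n : int) : int := (p * n %/ q)%Z.

Lemma staircaseP p q n : 0 < q -> 0 <= p * n - q * staircase p q n < q.
Proof.
move=> q0; rewrite /staircase {1 3}(divz_eq (p * n) q).
have -> : forall a b : int, a * q + b - q * a = b by move=> *; ring.
by rewrite modz_ge0 ?gt_eqF//= ltz_pmod.
Qed.

Lemma incrementsD S k : increments (fun n => S n + k) = increments S.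
Proof.
apply/funext => n; rewrite /increments.
by have -> : S (n + 1) + k - (S n + k) = S (n + 1) - S n by ring.
Qed.

(** Whatever the height of the line, a vertical translate of the staircase
    follows it, and the translation does not change the increments. *)
Lemma tube_staircase p q b : 0 < q ->
  exists k, tube p q b (fun n => staircase p q n + k).
Proof.
move=> q0.
(* the ceiling of [b / q] *)
exists ((b + q - 1) %/ q)%Z => n.
have := staircaseP p n q0; have := divz_eq (b + q - 1) q.
have := ltz_pmod (b + q - 1) q0.
have : 0 <= ((b + q - 1) %% q)%Z by rewrite modz_ge0 ?gt_eqF.
move: (_ %/ _)%Z (_ %% _)%Z (staircase _ _ _) => k r s r0 rq e /andP[h1 h2].
by rewrite ler_norml; lia.
Qed.

(** The line of slope [p / q] minus the staircase is at least 0 and less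
    than 1.  Lowering the second line by [1 / 2] centres this range in the tube,
    which leaves a margin of [1 / 2] for the drift between the two slopes.  The even
    denominator [2 h] makes this lowering an integer. *)
Lemma staircase_transfer p p' h (w : nat) : 0 < h -> `|p' - p| * w%:Z <= h ->
  exists b S, tube p' (2 * h) b S /\
    forall n : int, `|n| <= w%:Z -> S n = staircase p (2 * h) n.
Proof.
move=> h0 hw; have q0 : 0 < 2 * h by rewrite mulr_gt0.
exists (- h), (fun n => if `|n| <= w%:Z then staircase p (2 * h) n
                       else staircase p' (2 * h) n).
split; last by move=> n ->.
move=> n; case: ifPn => hn.
  have := staircaseP p n q0; move: (staircase _ _ _) => s /andP[s1 s2].
  have : `|(p' - p) * n| <= h.
    by rewrite normrM (le_trans _ hw)// ler_wpM2l.
  rewrite mulrBl !ler_norml; move: s1 s2.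
  move: (p' * n) (p * n) (2 * h * s) => x y z s1 s2 /andP[e1 e2].
  by apply/andP; split; lia.
have := staircaseP p' n q0; rewrite ler_norml; lia.
Qed.

(** Free concatenation.  With [M = 2 w + 2], translation by [(q M, p M)]
    preserves the line, hence the tube, and [q M] consecutive times are enough
    to contain [- w, ..., w + 1].  In each block of that length one may thus
    follow a translate of either walk: membership in a tube is a condition on
    each time separately. *)
Lemma tube_glue p q b (w : nat) (S0 S1 : int -> int) (c : int -> bool) : 0 < q ->
  tube p q b S0 -> tube p q b S1 ->
  exists2 S, tube p q b S &
    forall k r : int, - w%:Z <= r <= w%:Z + 1 ->
      S (k * (q * (2 * w + 2)%N) + r) =
      (if c k then S1 else S0) r + k * (p * (2 * w + 2)%N).
Proof.
move=> q0 h0 h1; set M : int := (2 * w + 2)%N.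
have M0 : 0 < M by rewrite /M; lia.
have L0 : 0 < q * M by rewrite mulr_gt0.
pose blk n := ((n + w%:Z) %/ (q * M))%Z.
exists (fun n => (if c (blk n) then S1 else S0) (n - blk n * (q * M)) +
                 blk n * (p * M)).
  move=> n; set k := blk n; set r := n - _.
  set s := (if c k then S1 else S0) r.
  have -> : q * (s + k * (p * M)) - p * n - b = q * s - p * r - b.
    by rewrite /r; ring.
  by rewrite /s; case: ifP.
move=> k r hr.
have -> : blk (k * (q * M) + r) = k.
  rewrite /blk -addrA divzMDl ?gt_eqF// divz_small ?addr0//.
  have : M <= q * M by rewrite ler_peMl; lia.
  by move: (q * M) M0 hr; rewrite /M => L; lia.
by have -> : k * (q * M) + r - k * (q * M) = r by ring.
Qed.

Definition balanced (x : int -> 'I_6) : Prop := exists p q b S,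
  [/\ 0 < q, 2 * q <= p <= 3 * q, tube p q b S & x = increments S].

Lemma tubeM p q b m S : 0 < m -> tube p q b S -> tube (p * m) (q * m) (b * m) S.
Proof.
move=> m0 St n.
have -> : q * m * S n - p * m * n - b * m = (q * S n - p * n - b) * m by ring.
by rewrite normrM (gtr0_norm m0) ler_pM2r.
Qed.

(** A property of sequences that is the same for all walks in a common tube and
    depends on a bounded window does not depend on the slope either. *)
Section slope_invariance.
Variables (P : (int -> 'I_6) -> Prop) (w : nat).
Hypothesis P_tube : forall p q b S S', 0 < q -> 2 * q <= p <= 3 * q ->
  tube p q b S -> tube p q b S' -> P (increments S) <-> P (increments S').
Hypothesis P_window : forall x y, balanced x -> balanced y ->
  (forall n : int, `|n| <= w%:Z -> x n = y n) -> P x <-> P y.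

Lemma invariant_staircase p q b S :
  0 < q -> 2 * q <= p <= 3 * q -> tube p q b S ->
  P (increments S) <-> P (increments (staircase p q)).
Proof.
move=> q0 pq St; have [k Stk] := @tube_staircase p q b q0.
by rewrite -(@incrementsD (staircase p q) k); exact: P_tube Stk.
Qed.

Lemma invariant_step p p' h : 0 < h -> 2 * (2 * h) <= p <= 3 * (2 * h) ->
  2 * (2 * h) <= p' <= 3 * (2 * h) ->
  `|p' - p| * (w.+1)%:Z <= h ->
  P (increments (staircase p (2 * h))) <->
  P (increments (staircase p' (2 * h))).
Proof.
move=> h0 ph ph' hpp; have q0 : 0 < 2 * h by rewrite mulr_gt0.
have [b [S [St Sst]]] := staircase_transfer h0 hpp.
rewrite -(invariant_staircase q0 ph' St); apply: P_window.
- have [k Stk] := @tube_staircase p (2 * h) 0 q0.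
  exists p, (2 * h), 0, (fun n => staircase p (2 * h) n + k); split => //.
  by rewrite incrementsD.
- by exists p', (2 * h), b, S.
(* an increment at time [n] reads the walk at [n + 1] as well, whence [w + 1] *)
- by move=> n hn; rewrite /increments !Sst//; lia.
Qed.

(** Join [p / q] to [2] by [2 (w + 1)] equal steps.  As [p / q - 2] is at most
    [1], each step is at most [1 / (2 (w + 1))] and drifts by at most [1 / 2]
    over the window.  With the common denominator [2 h], where [h = q (w + 1)], the
    intermediate slopes are [pj j / (2 h)]. *)
Lemma invariant_slope_two p q b S :
  0 < q -> 2 * q <= p <= 3 * q -> tube p q b S ->
  P (increments S) <-> P (increments (fun n => 2 * n)).
Proof.
move=> q0 pq St; pose h := q * (w.+1)%:Z.
have h0 : 0 < h by rewrite mulr_gt0.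
pose pj (j : nat) := 2 * (2 * h) + (p - 2 * q) * j%:Z.
have hd : 0 <= p - 2 * q <= q by move: pq; lia.
have pjP (j : nat) : (j <= 2 * w.+1)%N -> 2 * (2 * h) <= pj j <= 3 * (2 * h).
  move=> hj; move: hd => /andP[d0 d1].
  have : 0 <= (p - 2 * q) * j%:Z by rewrite mulr_ge0.
  have : (p - 2 * q) * j%:Z <= q * (2 * w.+1)%N by rewrite ler_pM.
  have -> : q * (2 * w.+1)%N = 2 * h by rewrite /h; lia.
  by rewrite /pj; lia.
have step (j : nat) : (j <= 2 * w.+1)%N ->
    P (increments (staircase (pj 0%N) (2 * h))) <->
    P (increments (staircase (pj j) (2 * h))).
  elim: j => [//|j IH] hj; rewrite IH ?(ltnW hj)//.
  apply: invariant_step => //; [exact/pjP/ltnW|exact/pjP|].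
  have -> : pj j.+1 - pj j = p - 2 * q by rewrite /pj; lia.
  by move: hd => /andP[d0 d1]; rewrite ger0_norm// /h ler_wpM2r.
have -> : (fun n => 2 * n) = staircase (pj 0%N) (2 * h).
  apply/funext => n; rewrite /staircase.
  have -> : pj 0%N * n = 2 * n * (2 * h) by rewrite /pj; ring.
  by rewrite mulzK// gt_eqF// mulr_gt0.
rewrite (step (2 * w.+1)%N)//.
have e1 : pj (2 * w.+1)%N = p * (2 * w.+1)%N by rewrite /pj /h; lia.
have e2 : 2 * h = q * (2 * w.+1)%N by rewrite /h; lia.
have := @tubeM p q b (2 * w.+1)%N S isT St.
rewrite -e1 -e2; apply: invariant_staircase; first by rewrite mulr_gt0.
exact: pjP.
Qed.

End slope_invariance.

(** * The subshift and its zero-dimensional factors *)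

(** Translating time by [k] moves the line by [p k / q] only. *)
Lemma balanced_translate k x : balanced x -> balanced (fun n => x (n + k)).
Proof.
move=> [p [q [b [S [q0 pq St ->]]]]]; exists p, q, (b + p * k), (fun n => S (n + k)).
split => // [n|].
  have -> : q * S (n + k) - p * n - (b + p * k) = q * S (n + k) - p * (n + k) - b by ring.
  exact: St.
by apply/funext => n; rewrite /increments addrAC.
Qed.

Definition balanced_closure : set (full_shift 'I_6) :=
  closure (balanced : set (full_shift 'I_6)).

Lemma balanced_closure_translate k (x : full_shift 'I_6) : balanced_closure x ->
  balanced_closure (fun n => x (n + k)).
Proof.
move=> /closureP Xx; apply/closureP => w.
have [y By xy] := Xx (w + absz k)%N.
exists (fun n => y (n + k)); first exact: balanced_translate.
by move=> n nw; apply: xy; lia.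
Qed.

Lemma balanced_in_closure x : balanced x -> balanced_closure x.
Proof. exact: subset_closure. Qed.

Lemma balanced_double : balanced (increments (fun n => 2 * n)).
Proof.
exists 2, 1, 0, (fun n => 2 * n); split => // n.
by rewrite mul1r !subrr normr0.
Qed.

Lemma balanced_triple : balanced (increments (fun n => 3 * n)).
Proof.
exists 3, 1, 0, (fun n => 3 * n); split => // n.
by rewrite mul1r !subrr normr0.
Qed.

Lemma balanced_closure_neq0 : balanced_closure !=set0.
Proof.
exists (increments (fun n => 2 * n)).
exact/balanced_in_closure/balanced_double.
Qed.

Lemma balanced_closure_closed : closed balanced_closure.
Proof. exact: closed_closure. Qed.

Lemma balanced_closure_shift : Defs.shift @` balanced_closure = balanced_closure.
Proof.
apply/seteqP; split => [_ [x Xx <-]|x Xx]; first exact: balanced_closure_translate.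
exists (fun n => x (n + (- 1))); first exact: balanced_closure_translate.
by apply/funext => n; rewrite /Defs.shift addrK.
Qed.

Definition balanced_subshift : subshift 'I_6 :=
  Subshift balanced_closure_neq0 balanced_closure_closed balanced_closure_shift.

Lemma subshift_map_iter (A : finType) (X : subshift A) k (x : X) :
  set_val (iter k (subshift_map X) x) =
  (fun n : int => set_val x (n + k%:Z)) :> full_shift A.
Proof.
rewrite -iter_shift; elim: k => [//|k IH].
by rewrite !iterS -IH.
Qed.

Lemma factor_iter (X Y : Type) (T : X -> X) (S : Y -> Y) (phi : X -> Y) k x :
  phi \o T = S \o phi -> phi (iter k T x) = iter k S (phi x).
Proof.
move=> e; elim: k => [//|k IH]; rewrite !iterS -IH.
by have := congr1 (@^~ (iter k T x)) e.
Qed.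

Definition subpoint (M : Type) (K : set M) (x : M) (Kx : K x) : K :=
  exist (fun x => x \in K) x (mem_set Kx).

Section factors.
Variables (R : realType) (Y : topologicalType) (S : Y -> Y).
Variables (phi : balanced_subshift -> Y) (D : set Y).
Hypothesis S_homeo : homeomorphism S.
Hypothesis phi_factor : factor_map (subshift_map balanced_subshift) S phi.
Hypothesis D_clopen : clopen D.
Hypothesis S_zero : ~ (0 < entropy R S)%E.

(* [P x] says that [phi x] is in [D], without requiring [x] to be packed with
   a proof that it belongs to the subshift. *)
Let P (x : full_shift 'I_6) : Prop :=
  exists h : x \in (balanced_subshift : set _), D (phi (exist _ x h)).

Let P_val (x : balanced_subshift) : P (set_val x) <-> D (phi x).
Proof.
split => [[h]|Dx].
  by have -> : exist _ (set_val x) h = x by exact: val_inj.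
exists (mem_set (set_valP x)).
by have -> : exist _ (set_val x) (mem_set (set_valP x)) = x by exact: val_inj.
Qed.

Let P_window : exists w, forall x y, balanced_closure x -> balanced_closure y ->
  agree w x y -> P x -> P y.
Proof.
have [Dpo Dpc] : clopen (phi @^-1` D).
  have [phic _] := phi_factor; have [Do Dc] := D_clopen.
  by split; [exact: open_comp|exact: closed_comp].
have [w wP] := clopen_window balanced_closure_closed (conj Dpo Dpc).
exists w => x y Xx Xy xy [h Dx]; exists (mem_set Xy).
exact: wP _ Dx.
Qed.

(** If the first walk lands outside [D] and the second inside, then gluing them
    along a 0-1 sequence [c] yields an orbit with [D]-name [c]. *)
Lemma same_line_status p q b S0 S1 : 0 < q -> 2 * q <= p <= 3 * q ->
  tube p q b S0 -> tube p q b S1 -> P (increments S1) -> P (increments S0).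
Proof.
move=> q0 pq t0 t1 P1; apply: contrapT => P0; apply: S_zero.
have [w wP] := P_window.
pose L := (absz q * (2 * w + 2))%N.
have L0 : (0 < L)%N by rewrite muln_gt0; lia.
apply: (entropy_gt0_of_names R S_homeo D_clopen L0) => c.
(* only the blocks to the right of the origin matter *)
have [S2 t2 S2E] := tube_glue w (fun k => c (absz k)) q0 t0 t1.
have B S' : tube p q b S' -> balanced_closure (increments S').
  by move=> ?; apply: balanced_in_closure; exists p, q, b, S'.
pose z : balanced_subshift := subpoint (B _ t2).
exists (phi z) => k; rewrite -(factor_iter _ _ phi_factor.2) -P_val subshift_map_iter.
set y := (fun n : int => _).
have Xy : balanced_closure y by exact: balanced_closure_translate (B _ t2).
have ya : agree w y (if c k then increments S1 else increments S0).
  move=> n nw.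
  have -> : y n = increments S2 (n + (k * L)%:Z) by [].
  rewrite {1}/increments.
  have -> : (k * L)%:Z = k%:Z * (q * (2 * w + 2)%N) by rewrite /L; lia.
  have -> : n + k%:Z * (q * (2 * w + 2)%N) + 1 =
            k%:Z * (q * (2 * w + 2)%N) + (n + 1) by ring.
  rewrite [n + k%:Z * _]addrC !S2E; [|lia|lia].
  have e (i j l : int) : i + l - (j + l) = i - j by ring.
  by rewrite e /=; case: (c k).
case: (c k) ya => ya; split => // h.
  exact: wP (B _ t1) Xy (agree_sym ya) P1.
by exfalso; apply: P0; exact: wP Xy (B _ t0) ya h.
Qed.

(** Every point of the closure agrees on the window with a balanced sequence,
    whose status is that of the constant sequence of slope [2]. *)
Lemma factor_clopen_trivial (x0 x : balanced_subshift) : D (phi x0) -> D (phi x).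
Proof.
have [w wP] := P_window.
suff h (z : balanced_subshift) : D (phi z) <-> P (increments (fun n => 2 * n)).
  by rewrite !h.
rewrite -P_val; have Xz : balanced_closure (set_val z) by exact: set_valP.
have /closureP/(_ w)[y [p [q [b [S' [q0 pq t ->]]]]] zy] := Xz.
have Xy : balanced_closure (increments S').
  by apply: balanced_in_closure; exists p, q, b, S'.
have <- : P (increments S') <-> P (increments (fun n => 2 * n)).
  apply: (@invariant_slope_two P w) q0 pq t.
    by move=> p' q' b' S0 S1 *; split; apply: same_line_status; eassumption.
  move=> x' y' /balanced_in_closure ? /balanced_in_closure ? xy.
  by split; apply: wP => //; exact: agree_sym.
by split; apply: wP => //; exact: agree_sym.
Qed.

End factors.

Lemma balanced_ZTCPE (R : realType) : ZTCPE R (subshift_map balanced_subshift).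
Proof.
move=> Y S phi [_ Sh] [B [_ Bbas] Bclopen] phif phis.
have [|S0] := pselect (0 < entropy R S)%E; [by left|right].
have [x Xx] := balanced_closure_neq0.
pose x0 : balanced_subshift := subpoint Xx.
exists (phi x0); apply/seteqP; split => // y _ /=; apply: contrapT => yx0.
have [x1 _ x1y] := phis y I.
have hY : hausdorff_space Y := @metric_hausdorff R Y.
have oy : open (~` [set y]).
  by rewrite openC; apply: accessible_closed_set1; exact: hausdorff_accessible.
have : nbhs (phi x0) (~` [set y]).
  by apply: open_nbhs_nbhs; split => // e; apply: yx0; rewrite -e.
move=> /Bbas[V [BV Vx0] Vy].
have := @factor_clopen_trivial R Y S phi V Sh phif (Bclopen _ BV) S0 x0 x1 Vx0.
by rewrite x1y => /Vy; apply.
Qed.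

(** * The slope factor *)

(** The image of the slope map has to be a metric space: a subset of a metric
    space carries the restricted distance. *)
Section set_type_metric.
Variables (R : realType) (M : metricType R) (K : set M).

Definition set_type_dist (x y : K) : R := mdist (set_val x) (set_val y).

Lemma set_type_dist_ge0 x y : 0 <= set_type_dist x y.
Proof. exact: mdist_ge0. Qed.

Lemma set_type_dist_positivity x y : set_type_dist x y = 0 -> x = y.
Proof. by move/mdist_positivity/val_inj. Qed.

Lemma set_type_ballE (x : K) (d : R) : ball x d = [set y | set_type_dist x y < d].
Proof.
have := ballEmdist (set_val x) d => e; apply/seteqP.
by split => y; rewrite /ball /= /initial_ball e.
Qed.

HB.instance Definition _ := PseudoMetric_isMetric.Build R (set_type K)
  set_type_dist_ge0 set_type_dist_positivity set_type_ballE.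

End set_type_metric.

Definition prefix_sum (x : int -> 'I_6) (n : nat) : nat :=
  (\sum_(i < n) x (i : nat)%:Z)%N.

Lemma prefix_sum_increments p q b S n :
  0 < q -> 2 * q <= p <= 3 * q -> tube p q b S ->
  (prefix_sum (increments S) n)%:Z = S n%:Z - S 0.
Proof.
move=> q0 pq St; elim: n => [|n IH]; first by rewrite /prefix_sum big_ord0 subrr.
rewrite /prefix_sum big_ord_recr /= PoszD -/(prefix_sum _ n) IH.
rewrite (increments_val _ q0 pq St).
have -> : n.+1%:Z = n%:Z + 1 by lia.
by ring.
Qed.

(** Both [prefix_sum x n / n] and [prefix_sum x m / m] are close to the slope,
    with errors [2 / n] and [2 / m].  Eliminating the slope leaves a condition
    on finitely many letters, which therefore passes to the closure. *)
Lemma prefix_sum_balanced x m n : balanced x ->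
  (m * prefix_sum x n <= n * prefix_sum x m + 2 * (m + n))%N.
Proof.
move=> [p [q [b [S [q0 pq St ->]]]]].
have near k : q * (prefix_sum (increments S) k)%:Z - p * k%:Z <= 2 * q /\
              - (2 * q) <= q * (prefix_sum (increments S) k)%:Z - p * k%:Z.
  rewrite (prefix_sum_increments k q0 pq St).
  have := St k%:Z; have := St 0.
  by rewrite !ler_norml mulrBr => /andP[a1 a2] /andP[a3 a4]; lia.
have [hn _] := near n; have [_ hm] := near m.
move: (prefix_sum _ n) (prefix_sum _ m) hn hm => a c hn hm.
have hn' : m%:Z * (q * a%:Z - p * n%:Z) <= m%:Z * (2 * q) by rewrite ler_wpM2l.
have hm' : n%:Z * (- (2 * q)) <= n%:Z * (q * c%:Z - p * m%:Z) by rewrite ler_wpM2l.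
suff : m%:Z * a%:Z <= n%:Z * c%:Z + 2 * (m%:Z + n%:Z) by lia.
rewrite -(ler_pM2l q0).
have -> : q * (m%:Z * a%:Z) = m%:Z * (q * a%:Z - p * n%:Z) + p * (m%:Z * n%:Z) by ring.
have -> : q * (n%:Z * c%:Z + 2 * (m%:Z + n%:Z)) = n%:Z * (q * c%:Z - p * m%:Z) +
   p * (m%:Z * n%:Z) + (m%:Z * (2 * q)) - n%:Z * (- (2 * q)) by ring.
by lia.
Qed.

Lemma eq_prefix_sum n (x y : full_shift 'I_6) :
  agree n x y -> prefix_sum x n = prefix_sum y n.
Proof. by move=> xy; apply: eq_bigr => i _; rewrite xy//; have := ltn_ord i; lia. Qed.

Lemma prefix_sum_closure (x : full_shift 'I_6) m n : balanced_closure x ->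
  (m * prefix_sum x n <= n * prefix_sum x m + 2 * (m + n))%N.
Proof.
move=> /closureP/(_ (maxn m n))[y By xy].
rewrite (@eq_prefix_sum n x y) ?(@eq_prefix_sum m x y); first exact: prefix_sum_balanced.
  by apply: agreeW xy; rewrite leq_maxl.
by apply: agreeW xy; rewrite leq_maxr.
Qed.

Section slope.
Variable R : realType.

(** The supremum of the lower bounds [(prefix_sum x n - 2) / n] for the slope.  A
    supremum exists for every sequence, and for points of the subshift each
    [(prefix_sum x m + 2) / m] is an upper bound. *)
Definition slope (x : full_shift 'I_6) : R :=
  sup [set ((prefix_sum x n)%:R - 2) / n%:R | n in [set n : nat | (0 < n)%N]].

Lemma slopeP x n : balanced_closure x -> (0 < n)%N ->
  `|n%:R * slope x - (prefix_sum x n)%:R| <= 2.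
Proof.
move=> Xx n0; pose E : set R :=
  [set ((prefix_sum x n)%:R - 2) / n%:R | n in [set n : nat | (0 < n)%N]].
have ub m : (0 < m)%N -> ubound E (((prefix_sum x m)%:R + 2) / m%:R).
  move=> m0 _ [k k0 <-].
  rewrite ler_pdivrMr ?ltr0n// mulrAC ler_pdivlMr ?ltr0n//.
  have := prefix_sum_closure m k Xx.
  by rewrite -(ler_nat R) !natrD !natrM; lra.
have E0 : E !=set0 by exists (((prefix_sum x n)%:R - 2) / n%:R), n.
have up : slope x <= ((prefix_sum x n)%:R + 2) / n%:R by apply: ge_sup => //; exact: ub.
have lo : ((prefix_sum x n)%:R - 2) / n%:R <= slope x.
  apply: ub_le_sup; last by exists n.
  by exists (((prefix_sum x n)%:R + 2) / n%:R); exact: ub.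
move: up lo; rewrite ler_pdivlMr ?ltr0n// ler_pdivrMr ?ltr0n// => up lo.
by rewrite ler_norml; apply/andP; split; lra.
Qed.

(** The constant [5] is the largest letter: this covers both equal prefixes and
    prefixes that differ by a shift of one place. *)
Lemma slope_near x y n : balanced_closure x -> balanced_closure y -> (0 < n)%N ->
  (prefix_sum x n <= prefix_sum y n + 5)%N ->
  (prefix_sum y n <= prefix_sum x n + 5)%N ->
  n%:R * `|slope x - slope y| <= 9.
Proof.
move=> Xx Xy n0; rewrite -!(ler_nat R) !natrD => h1 h2.
rewrite -{1}[n%:R]ger0_norm// -normrM mulrBr.
have := slopeP Xx n0; have := slopeP Xy n0.
by rewrite !ler_norml => /andP[a1 a2] /andP[a3 a4]; apply/andP; split; lra.
Qed.

Lemma slope_shift (x : full_shift 'I_6) :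
  balanced_closure x -> slope (Defs.shift x) = slope x.
Proof.
move=> Xx; have XTx : balanced_closure (Defs.shift x).
  exact: balanced_closure_translate.
have bnd n : (0 < n)%N -> n%:R * `|slope (Defs.shift x) - slope x| <= 9.
  move=> n0.
  have e : (prefix_sum (Defs.shift x) n + x 0 = prefix_sum x n + x n%:Z)%N.
    have -> : (prefix_sum x n + x n%:Z = prefix_sum x n.+1)%N.
      by rewrite /prefix_sum big_ord_recr.
    rewrite /prefix_sum big_ord_recl addnC; congr (_ + _)%N.
    by apply: eq_bigr => i _; rewrite /Defs.shift /= -[bump _ _]addn1 PoszD.
  move: e (ltn_ord (x 0)) (ltn_ord (x n%:Z)) => e h0 hn.
  apply: slope_near => //; clear -e h0 hn;
  move: (nat_of_ord _) (nat_of_ord _) (prefix_sum _ n) (prefix_sum _ n) e h0 hn;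
  by move=> a b c d; lia.
apply/eqP; rewrite -subr_eq0 -normr_eq0; apply: contraT => d0.
have dp : 0 < `|slope (Defs.shift x) - slope x| by rewrite lt_neqAle eq_sym d0 /=.
have := bnd (Num.truncn (9 / `|slope (Defs.shift x) - slope x|)).+1 isT.
rewrite -ler_pdivlMr// leNgt => /negP[]; exact: truncnS_gt.
Qed.

Definition subshift_slope (x : balanced_subshift) : R^o := slope (set_val x).

Lemma subshift_slope_continuous : continuous subshift_slope.
Proof.
move=> x V /nbhs_ballP[e /= e0 eV].
pose n := (Num.truncn (9 / e)).+1.
apply/set_type_nbhsP; exists n => y xy; apply: eV; rewrite /ball /=.
have [Xx Xy] : balanced_closure (set_val x) /\ balanced_closure (set_val y).
  by split; exact: set_valP.
have s := eq_prefix_sum xy.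
have := @slope_near (set_val x) (set_val y) n Xx Xy isT.
rewrite s leq_addr => /(_ isT isT) h.
rewrite /subshift_slope -(@ltr_pM2l _ n%:R) ?ltr0n// (le_lt_trans h)//.
by rewrite -ltr_pdivrMr// truncnS_gt.
Qed.

(** The bound for prefixes of length [10] already separates the slopes [2] and
    [3]. *)
Lemma slope_multiple (k : nat) : (k <= 5)%N ->
  balanced_closure (increments (fun n => k%:Z * n)) ->
  `|slope (increments (fun n => k%:Z * n)) - k%:R| <= 5^-1.
Proof.
move=> k5 Xk; have := @slopeP _ 10 Xk isT.
have -> : prefix_sum (increments (fun n => k%:Z * n)) 10 = (10 * k)%N.
  rewrite /prefix_sum (eq_bigr (fun=> k)) ?sum_nat_const ?card_ord// => i _.
  have e (m : int) : k%:Z * (m + 1) - k%:Z * m = k%:Z by ring.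
  by rewrite /increments e absz_nat inordK.
rewrite natrM !ler_norml => /andP[h1 h2]; apply/andP; split; lra.
Qed.

Lemma balanced_not_TCPE : ~ TCPE R (subshift_map balanced_subshift).
Proof.
pose Y : metricType R := set_type (range subshift_slope).
pose phi (x : balanced_subshift) : Y := subpoint (imageT subshift_slope x).
have phic : continuous phi by apply: continuous_comp_initial; exact: subshift_slope_continuous.
have phis : set_surj setT setT phi.
  by move=> [y hy] _; have [x _ xy] := set_mem hy; exists x => //; apply: val_inj.
have Xc : compact [set: balanced_subshift].
  apply: compact_set_type; apply: subclosed_compact (@full_shift_compact _) _ => //.
  exact: balanced_closure_closed.
have Yc : compact [set: Y].
  have -> : [set: Y] = phi @` setT.
    by apply/seteqP; split => // y _; have [x _ <-] := phis y I; exists x.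
  by apply: continuous_compact => //; exact: continuous_subspaceT.
have Yid : is_tds (@id Y).
  split => //; split; first by move=> ?.
  by exists id; split => // ?.
have phif : factor_map (subshift_map balanced_subshift) (@id Y) phi.
  split => //; apply/funext => x; apply: val_inj; apply: slope_shift; exact: set_valP.
move=> /(_ Y id phi Yid phif phis)[|[y Yy]].
  by apply/negP; rewrite -leNgt entropy_id_le0.
have X2 := balanced_in_closure balanced_double.
have X3 := balanced_in_closure balanced_triple.
have e : phi (subpoint X2) = phi (subpoint X3).
  have : [set: Y] (phi (subpoint X2)) by [].
  have : [set: Y] (phi (subpoint X3)) by [].
  by rewrite Yy => -> ->.
have {}e : slope (increments (fun n => 2 * n)) =
  slope (increments (fun n => 3 * n)) := congr1 val e.
have h3 : `|slope (increments (fun n => 3 * n)) - 3| <= 5^-1.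
  exact: (@slope_multiple 3 isT X3).
have : `|slope (increments (fun n => 2 * n)) - 2| <= 5^-1.
  exact: (@slope_multiple 2 isT X2).
move: h3; rewrite e; move: (slope _) => s; clear.
by rewrite !ler_norml => /andP[h1 h2] /andP[h3 h4]; lra.
Qed.

End slope.

Theorem theorem1p1 (R : realType) :
  exists (A : finType) (X : subshift A),
    ZTCPE R (subshift_map X) /\ ~ TCPE R (subshift_map X).
Proof.
exists 'I_6, balanced_subshift; split.
  exact: balanced_ZTCPE.
exact: balanced_not_TCPE.
Qed.
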